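(* For every $n\ge1$, there is a bijection between the intervals of $\mathbb{F}_n^2$ and the bicolored Motzkin paths of length $n-1$ avoiding the seven patterns $F_2F_2,\ F_2D,\ F_2U,\ DF_2,\ UF_2,\ UU,\ DD$.
   Context: A Dyck path of semilength $n\ge 0$ is a lattice path from $(0,0)$ to $(2n,0)$ with steps $U=(1,1)$ and $D=(1,-1)$ that never goes below the $x$-axis; it is identified with its word over $\{U,D\}$. A path (or word) avoids a pattern $\alpha$ if $\alpha$ does not occur as a factor (block of consecutive steps). $\mathcal{F}_n^2$ is the set of Dyck paths of semilength $n$ avoiding $DUU$ and $DDD$, ordered by the Stanley order: $P\le Q$ iff $P$ lies weakly below $Q$ when both are drawn in the plane; $\mathbb{F}_n^2=(\mathcal{F}_n^2,\le)$. An interval is a set $[P,Q]=\{R:P\le R\le Q\}$ with $P\le Q$. A bicolored Motzkin path of length $m$ is a lattice path in the quarter plane $\{y\ge0\}$ starting at $(0,0)$, consisting of $m$ steps each among $U=(1,1)$, $D=(1,-1)$, $F_1=(1,0)$, $F_2=(1,0)$ (two distinguishable kinds of flat steps), with arbitrary endpoint height; it is identified with its word over $\{U,D,F_1,F_2\}$. *)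

(* Defs.v *)
From HB Require Import structures.
From mathcomp Require Import all_boot all_order all_algebra.

Set Implicit Arguments.
Unset Strict Implicit.
Unset Printing Implicit Defensive.

Import Order.TTheory GRing.Theory Num.Theory.

(* The path of the word w starts at height 0; its height after i steps is
   height rise (take i w), where rise s is the vertical displacement of s. *)
Definition height (T : Type) (rise : T -> int) (w : seq T) : int :=
  (\sum_(s <- w) rise s)%R.

Definition nonneg_path (T : Type) (rise : T -> int) (w : seq T) : bool :=
  [forall i : 'I_(size w).+1, (0 <= height rise (take i w))%R].

Definition avoids (T : eqType) (w pattern : seq T) : bool := ~~ infix pattern w.

Inductive dyck_step := Up | Down.

Definition bool_of_dyck_step (s : dyck_step) : bool :=
  if s is Up then true else false.
Definition dyck_step_of_bool (b : bool) : dyck_step := if b then Up else Down.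
Lemma dyck_step_boolK : cancel bool_of_dyck_step dyck_step_of_bool.
Proof. by case. Qed.
HB.instance Definition _ := Finite.copy dyck_step (can_type dyck_step_boolK).

Definition dyck_rise (s : dyck_step) : int :=
  match s with Up => 1%R | Down => (-1)%R end.

Definition is_dyck (w : seq dyck_step) : bool :=
  nonneg_path dyck_rise w && (height dyck_rise w == 0%R).

Record F2 (n : nat) := MkF2 {
  F2_word :> (n.*2).-tuple dyck_step;
  _ : [&& is_dyck F2_word,
          avoids F2_word [:: Down; Up; Up]
        & avoids F2_word [:: Down; Down; Down]]
}.

HB.instance Definition _ (n : nat) := [isSub for @F2_word n].
HB.instance Definition _ (n : nat) := [Finite of F2 n by <:].

(* Two paths of the same length are piecewise linear with vertices at the
   integral abscissae, so comparing their heights there is enough. *)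
Definition stanley_le (n : nat) (P Q : F2 n) : bool :=
  [forall i : 'I_(n.*2).+1,
     (height dyck_rise (take i P) <= height dyck_rise (take i Q))%R].

Lemma dyck_rise_inj : injective dyck_rise.
Proof. by case; case. Qed.

Lemma height_inj (T : Type) (rise : T -> int) (v w : seq T) :
    injective rise -> size v = size w ->
    (forall i, i <= size v ->
       height rise (take i v) = height rise (take i w)) ->
  v = w.
Proof.
move=> rise_inj; elim: v w => [|x v IHv] [|y w] //= [eq_sz] eq_h.
have eq_xy : x = y.
  by apply: rise_inj; have := eq_h 1 isT; rewrite /= !take0 /height !big_seq1.
rewrite eq_xy; congr cons; apply: IHv => // i le_i.
have := eq_h i.+1 le_i; rewrite /= /height !big_cons eq_xy.
exact: addrI.
Qed.

Lemma stanley_le_refl (n : nat) : reflexive (@stanley_le n).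
Proof. by move=> P; apply/forallP. Qed.

Lemma stanley_le_anti (n : nat) : antisymmetric (@stanley_le n).
Proof.
move=> P Q /andP[/forallP lePQ /forallP leQP].
apply/val_inj/val_inj/(height_inj dyck_rise_inj); rewrite /= !size_tuple //.
move=> i le_i; have lt_i : i < (n.*2).+1 by [].
apply/eqP; rewrite eq_le.
by rewrite (lePQ (Ordinal lt_i)) (leQP (Ordinal lt_i)).
Qed.

Lemma stanley_le_trans (n : nat) : transitive (@stanley_le n).
Proof.
move=> Q P S /forallP lePQ /forallP leQS; apply/forallP => i.
exact: le_trans (lePQ i) (leQS i).
Qed.

Fact stanley_display : Order.disp_t. Proof. exact: Order.Disp tt tt. Qed.

HB.instance Definition _ (n : nat) :=
  Order.Le_isPOrder.Build stanley_display (F2 n)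
    (@stanley_le_refl n) (@stanley_le_anti n) (@stanley_le_trans n).

Definition is_interval (d : Order.disp_t) (T : finPOrderType d) (I : {set T}) :
    bool :=
  [exists P : T, [exists Q : T,
     (P <= Q)%O && (I == [set R : T | (P <= R <= Q)%O])]].

Inductive motzkin_step := MU | MD | MF1 | MF2.

Definition bools_of_motzkin_step (s : motzkin_step) : bool * bool :=
  match s with
  | MU => (true, true) | MD => (true, false)
  | MF1 => (false, true) | MF2 => (false, false)
  end.
Definition motzkin_step_of_bools (b : bool * bool) : motzkin_step :=
  match b with
  | (true, true) => MU | (true, false) => MD
  | (false, true) => MF1 | (false, false) => MF2
  end.
Lemma motzkin_step_boolsK : cancel bools_of_motzkin_step motzkin_step_of_bools.
Proof. by case. Qed.
HB.instance Definition _ :=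
  Finite.copy motzkin_step (can_type motzkin_step_boolsK).

Definition motzkin_rise (s : motzkin_step) : int :=
  match s with MU => 1%R | MD => (-1)%R | MF1 | MF2 => 0%R end.

(* No condition on the final height. *)
Definition is_motzkin (w : seq motzkin_step) : bool :=
  nonneg_path motzkin_rise w.

Definition motzkin_patterns : seq (seq motzkin_step) :=
  [:: [:: MF2; MF2]; [:: MF2; MD]; [:: MF2; MU]; [:: MD; MF2]; [:: MU; MF2];
      [:: MU; MU]; [:: MD; MD]].

(* Main.v *)
(** Past its initial run of ups, a path of [F2 n] is [D ? D ? ... ? D] with [n]
    downs, where each of the [n - 1] gaps [?] is either empty or a single [U],
    and [DDD] is avoided iff no two consecutive gaps are empty.  The final
    height forces the initial run to have one more [U] than there are empty
    gaps, and the path is then automatically nonnegative.  The [j]-th down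
    (from 0) is at abscissa [2 j + 1 + e], where [e] counts the empty gaps from
    the [j]-th one on, so [P <= Q] iff every suffix of the gap word of [Q] has
    at least as many empty gaps as that of [P].  Reading the gaps of [P] and [Q]
    in parallel from right to left, and writing [MU] (resp. [MD], [MF2], [MF1])
    when the gap is empty in [Q] only (resp. in [P] only, in both, in neither),
    this becomes the nonnegativity of a Motzkin path, and the seven patterns are
    the pairs of consecutive letters in which [P] or [Q] has two empty gaps. *)
Require Import Defs.
From mathcomp Require Import all_boot all_order all_algebra zify.

Set Implicit Arguments.
Unset Strict Implicit.
Unset Printing Implicit Defensive.

Import Order.TTheory GRing.Theory Num.Theory.

(** * Bijections from relations, and endpoints of intervals *)

Lemma rel_bijection (A B : finType) (r : A -> B -> Prop) :
    (forall a, exists b, r a b) -> (forall b, exists a, r a b) ->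
    (forall a b b', r a b -> r a b' -> b = b') ->
    (forall a a' b, r a b -> r a' b -> a = a') ->
  exists f : A -> B, bijective f.
Proof.
move=> /fin_all_exists[f fP] /fin_all_exists[g gP] rfun rinj.
by exists f, g => [a|b]; [apply: rinj (gP _) (fP _)|apply: rfun (fP _) (gP _)].
Qed.

(** The endpoints belong to their own interval, hence to the other one, and antisymmetry applies. *)
Lemma itv_inj (d : Order.disp_t) (T : finPOrderType d) (P Q P' Q' : T) :
    (P <= Q)%O -> (P' <= Q')%O ->
    [set R : T | (P <= R <= Q)%O] = [set R : T | (P' <= R <= Q')%O] ->
  P = P' /\ Q = Q'.
Proof.
move=> lePQ lePQ' /setP eqI.
have memE R : (P <= R <= Q)%O = (P' <= R <= Q')%O.
  by have := eqI R; rewrite !inE.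
have /andP[P'P _] : (P' <= P <= Q')%O by rewrite -memE lexx.
have /andP[_ QQ'] : (P' <= Q <= Q')%O by rewrite -memE lexx andbT.
have /andP[PP' _] : (P <= P' <= Q)%O by rewrite memE lexx.
have /andP[_ Q'Q] : (P <= Q' <= Q)%O by rewrite memE lexx andbT.
by split; apply: le_anti; apply/andP.
Qed.

(** * The paths of F2 *)

Definition sparse (s : seq bool) : bool := sorted (fun a b => ~~ (a && b)) s.

Lemma sparse_rev s : sparse (rev s) = sparse s.
Proof.
by rewrite /sparse rev_sorted; apply: eq_sorted => a b; rewrite andbC.
Qed.

(* [true] stands for an empty gap between two consecutive downs. *)
Fixpoint descent (s : seq bool) : seq dyck_step :=
  if s is b :: s' then Down :: (if b then descent s' else Up :: descent s')
  else [:: Down].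

Definition gap_path (s : seq bool) : seq dyck_step :=
  nseq (count id s).+1 Up ++ descent s.

Notation downs := (count_mem Down).

Lemma size_descent s : size (descent s) = (size s).*2.+1 - count id s.
Proof.
elim: s => //= b s IHs; have := count_size id s.
by case: b; rewrite /= IHs /=; lia.
Qed.

Lemma downs_descent s : downs (descent s) = (size s).+1.
Proof. by elim: s => //= -[] s /= ->. Qed.

Lemma size_gap_path s : size (gap_path s) = (size s).+1.*2.
Proof.
rewrite size_cat size_nseq size_descent; have := count_size id s.
by lia.
Qed.

Lemma downs_gap_path s : downs (gap_path s) = (size s).+1.
Proof. by rewrite count_cat count_nseq downs_descent. Qed.

(** Locates down [j] (from 0) in the descent: it is preceded by [j] downs and by one up for each
    nonempty gap among the first [j]. *)
Lemma ltn_downs_take_descent s i j : j <= size s ->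
  (j < downs (take i (descent s))) = (j.*2 - count id (take j s) < i).
Proof.
elim: s i j => [|b s IHs] [|i] [|j] //= le_j; rewrite ?eqxx ?ltn0 //.
rewrite add1n ltnS; have le_c := count_size id (take j s).
rewrite size_take_min in le_c.
case: b => /=; first by rewrite IHs //; lia.
case: i => [|i] /=; first by lia.
by rewrite add0n IHs //; lia.
Qed.

(** The initial run shifts positions by [(count id s).+1]; the empty gaps before down [j] cancel, so
    only those from [j] on remain. *)
Lemma ltn_downs_take s i j : j <= size s ->
  (j < downs (take i (gap_path s))) = (j.*2.+1 + count id (drop j s) < i).
Proof.
move=> le_j; rewrite /gap_path take_cat size_nseq.
have eqc : count id s = count id (take j s) + count id (drop j s).
  by rewrite -count_cat cat_take_drop.
have := count_size id (take j s); rewrite size_take_min => le_c.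
have [lt_i|le_i] := ltnP i (count id s).+1.
  by rewrite (take_nseq _ (ltnW lt_i)) count_nseq mul0n ltn0; lia.
by rewrite count_cat count_nseq mul0n add0n ltn_downs_take_descent //; lia.
Qed.

Lemma height_dyck w :
  height dyck_rise w = ((size w)%:Z - (downs w).*2%:Z)%R.
Proof.
elim: w => [|x w IHw]; first by rewrite /height big_nil.
by rewrite /height big_cons -/(height _ _) IHw; case: x => /=; lia.
Qed.

Lemma gap_path_dyck s : is_dyck (gap_path s).
Proof.
apply/andP; split; last first.
  by rewrite height_dyck size_gap_path downs_gap_path subrr.
apply/forallP => -[i /= le_i]; rewrite height_dyck size_takel //.
case def_c: (downs _) => [|j]; first by lia.
have le_j : j <= size s.
  rewrite -ltnS -def_c -(downs_gap_path s).
  by rewrite -{2}(cat_take_drop i (gap_path s)) count_cat leq_addr.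
(* A prefix containing down [j] has length at least [2 * j + 2], twice its number of downs. *)
by have := ltn_downs_take i le_j; rewrite def_c ltnSn; lia.
Qed.

Lemma avoids_nseq_Up k w p :
  avoids (nseq k Up ++ w) (Down :: p) = avoids w (Down :: p).
Proof. by elim: k. Qed.

Lemma gap_path_avoids_DUU s : avoids (gap_path s) [:: Down; Up; Up].
Proof.
rewrite avoids_nseq_Up /avoids.
by elim: s => [|[] [|b s]] //= /norP[_ ->].
Qed.

Lemma gap_path_avoids_DDD s :
  avoids (gap_path s) [:: Down; Down; Down] = sparse s.
Proof.
rewrite avoids_nseq_Up /avoids /sparse.
elim: s => [|a [|b s] IHs] //=; first by case: a.
have [v def_v] : exists v, descent s = Down :: v by case: (s) => *; eexists.
move: IHs; rewrite /= def_v.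
by case: a b => -[] /=; rewrite ?prefix0s //= => ->.
Qed.

(** A final up would leave from height -1. *)
Lemma last_dyck w : is_dyck w -> 0 < size w -> last Up w = Down.
Proof.
case/lastP: w => // w x /andP[/forallP nonneg /eqP]; rewrite last_rcons => h0 _.
have lt_w : size w < (size (rcons w x)).+1 by rewrite size_rcons.
have := nonneg (Ordinal lt_w); move: h0.
rewrite /= -cats1 take_size_cat // !height_dyck size_cat count_cat.
by case: x {nonneg lt_w} => //=; lia.
Qed.

Lemma split_initial_ups w :
  last Up w = Down -> exists k v, w = nseq k Up ++ Down :: v.
Proof.
elim: w => // -[|] w IHw /=; last by exists 0, w.
by case/IHw => k [v ->]; exists k.+1, v.
Qed.

Lemma descent_surj v :
    avoids (Down :: v) [:: Down; Up; Up] -> last Down v = Down ->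
  exists s, Down :: v = descent s.
Proof.
(* Strong induction on the length, since a nonempty gap consumes two letters: an up after a down is
   followed by a down, as [DUU] is avoided and the word ends with a down. *)
have [m] := ubnP (size v); elim: m v => // m IHm [|[|] v] /=.
- by exists [::].
- case: v => [|[|] v] //=; first by rewrite /avoids /= prefix0s.
  move=> /ltnSE/ltnW le_v; rewrite /avoids /= => avd lst.
  by have [|//|s ->] := IHm v le_v; [|exists (false :: s)].
- rewrite ltnS => lt_v; rewrite /avoids /= => avd lst.
  by have [|//|s ->] := IHm v lt_v; [|exists (true :: s)].
Qed.

Lemma F2_gap_path n s :
  size s = n -> sparse s -> exists P : F2 n.+1, P = gap_path s :> seq _.
Proof.
move=> <- sp; have sz : size (gap_path s) == (size s).+1.*2.
  by rewrite size_gap_path.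
have Ps : [&& is_dyck (Tuple sz), avoids (Tuple sz) [:: Down; Up; Up]
             & avoids (Tuple sz) [:: Down; Down; Down]].
  by rewrite /= gap_path_dyck gap_path_avoids_DUU gap_path_avoids_DDD.
by exists (MkF2 Ps).
Qed.

Lemma gap_pathP n (P : F2 n.+1) :
  exists s, [/\ size s = n, sparse s & P = gap_path s :> seq _].
Proof.
case: P => w /= /and3P[dyck_w DUU DDD]; have sz := size_tuple w.
have := last_dyck dyck_w; rewrite sz => /(_ isT) lst.
have [k [v def_w]] := split_initial_ups lst.
have [||s def_v] := @descent_surj v.
- by rewrite def_w avoids_nseq_Up in DUU.
- by rewrite def_w last_cat in lst.
rewrite def_v in def_w.
have /andP[_ /eqP] := dyck_w; rewrite height_dyck sz.
have := sz; rewrite def_w size_cat count_cat size_nseq count_nseq mul0n.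
rewrite size_descent downs_descent => szk h0; have le_c := count_size id s.
(* Length and final height give the number of downs, hence [size s = n], and then the length of the
   initial run. *)
have def_k : k = (count id s).+1 by lia.
exists s; split; rewrite ?def_w ?def_k //; first by lia.
by rewrite -gap_path_avoids_DDD /gap_path -def_k -def_w.
Qed.

(** * The Stanley order in terms of gaps *)

Lemma stanley_le_downs n (P Q : F2 n) :
  (P <= Q)%O <-> forall i, downs (take i Q) <= downs (take i P).
Proof.
have heightE (S : F2 n) i : i <= n.*2 ->
    height dyck_rise (take i S) = (i%:Z - (downs (take i S)).*2%:Z)%R.
  by move=> le_i; rewrite height_dyck size_takel // size_tuple.
split=> [/forallP le_h i | le_d]; last first.
  apply/forallP => -[i le_i] /=; rewrite !heightE //.
  by have := le_d i; lia.
wlog le_i : i / i <= n.*2 => [hw|].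
  have [/hw //|lt_i] := leqP i n.*2.
  by have := hw _ (leqnn _); rewrite !take_oversize ?size_tuple // ltnW.
have lt_i : i < n.*2.+1 by [].
have := le_h (Ordinal lt_i).
by rewrite /= !heightE // lerD2l lerN2 lez_nat leq_double.
Qed.

Lemma stanley_le_gaps n (P Q : F2 n.+1) s t :
    size s = n -> size t = n ->
    P = gap_path s :> seq _ -> Q = gap_path t :> seq _ ->
  (P <= Q)%O <-> forall j, count id (drop j s) <= count id (drop j t).
Proof.
move=> szs szt defP defQ; rewrite stanley_le_downs defP defQ.
split=> [le_d j | le_c i].
  have [le_j|lt_j] := leqP j n; last by rewrite drop_oversize // szs ltnW.
  (* This is the shortest prefix length at which [Q] has made down [j]; by then [P] has made it
     too. *)
  have := leq_trans _ (le_d (j.*2.+1 + count id (drop j t)).+1).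
  move=> /(_ j.+1); rewrite !ltn_downs_take ?szs ?szt // => /(_ (ltnSn _)).
  by rewrite ltnS leq_add2l.
(* Down [j] is the last one in this prefix of [Q]; in [P] it comes no later. *)
case def_c: (downs (take i (gap_path t))) => [//|j].
have le_j : j <= n.
  rewrite -ltnS -def_c -szt -(downs_gap_path t).
  by rewrite -{2}(cat_take_drop i (gap_path t)) count_cat leq_addr.
have le_js : j <= size s by rewrite szs.
have le_jt : j <= size t by rewrite szt.
have := ltn_downs_take i le_jt; rewrite def_c ltnSn => /esym lt_i.
rewrite ltn_downs_take //; apply: leq_ltn_trans lt_i.
by rewrite leq_add2l.
Qed.

Lemma gap_path_inj : injective gap_path.
Proof.
move=> s t eq_st; have : descent s = descent t.
  have eq_c : count id s = count id t; last first.
    by have /eqP := eq_st; rewrite /gap_path eq_c eqseq_cat // => /andP[_ /eqP].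
  have hd r : find (pred1 Down) (gap_path r) = (count id r).+1.
    rewrite find_cat has_nseq andbF size_nseq.
    by case: r => [|b r] /=; rewrite addn0.
  by have := hd s; rewrite eq_st hd => -[].
(* A descent starts with [Down], so the letter after it, if any, tells whether the first gap is
   empty. *)
elim: s t {eq_st} => [|a s IHs] [|b t] //=.
- by case: b => -[]; case: t.
- by case: a => -[]; case: s {IHs}.
- case: a b => -[] [] //.
  + by move/IHs->.
  + by case: s {IHs}.
  + by case: t.
  + by move/IHs->.
Qed.

(** * Motzkin words *)

Definition low_gap (x : motzkin_step) : bool :=
  if x is (MD | MF2) then true else false.
Definition high_gap (x : motzkin_step) : bool :=
  if x is (MU | MF2) then true else false.

Lemma gaps_inj v w :
    map low_gap v = map low_gap w -> map high_gap v = map high_gap w ->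
  v = w.
Proof.
by elim: v w => [|x v IHv] [|y w] //= [xy1 vw1] [xy2 /(IHv _ vw1) ->];
  case: x y xy1 xy2 => -[].
Qed.

Lemma gaps_surj s t :
    size s = size t -> exists w, map low_gap w = s /\ map high_gap w = t.
Proof.
elim: s t => [|a s IHs] [|b t] //= => [_|[/IHs[w [<- <-]]]].
  by exists [::].
exists ((if a then if b then MF2 else MD else if b then MU else MF1) :: w).
by case: a b => -[].
Qed.

(** Sparsity of the low gaps forbids the four pairs over [MD], [MF2], that of the high gaps the four
    over [MU], [MF2]; they share [MF2 MF2], whence seven patterns. *)
Lemma avoids_motzkin_patterns w :
  all (avoids w) motzkin_patterns =
  sparse (map low_gap w) && sparse (map high_gap w).
Proof.
have avoids2 a b x y v : avoids [:: x, y & v] [:: a; b] =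
    ~~ ((a == x) && (b == y)) && avoids (y :: v) [:: a; b].
  by rewrite /avoids [infix _ (x :: _)]/= prefix0s andbT negb_or.
elim: w => [|x [|y w] IHw] //; first by case: x.
move: IHw; rewrite /sparse /= !avoids2.
by case: x y => -[] /= IHw; rewrite ?IHw ?andbF.
Qed.

Lemma is_motzkin_gaps w :
  is_motzkin w <->
  forall i, count low_gap (take i w) <= count high_gap (take i w).
Proof.
have heightE v :
    height motzkin_rise v = ((count high_gap v)%:Z - (count low_gap v)%:Z)%R.
  elim: v => [|x v IHv]; first by rewrite /height big_nil.
  by rewrite /height big_cons -/(height _ _) IHv; case: x => /=; lia.
split=> [/forallP nonneg i | le_c]; last first.
  by apply/forallP => -[i _] /=; rewrite heightE; have := le_c i; lia.
wlog le_i : i / i <= size w => [hw|].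
  have [/hw //|lt_i] := leqP i (size w).
  by have := hw _ (leqnn _); rewrite !take_oversize // ltnW.
have lt_i : i < (size w).+1 by [].
by have := nonneg (Ordinal lt_i); rewrite /= heightE; lia.
Qed.

(** Reversal turns prefixes of the Motzkin word into the suffixes of gap words that govern the
    order. *)
Lemma is_motzkin_drop_rev w :
  is_motzkin w <->
  forall j, count id (drop j (rev (map low_gap w))) <=
            count id (drop j (rev (map high_gap w))).
Proof.
rewrite is_motzkin_gaps.
have dropE (f : motzkin_step -> bool) j :
    count id (drop j (rev (map f w))) = count f (take (size w - j) w).
  by rewrite drop_rev count_rev size_map -map_take count_map.
split=> [le_c j|le_c i]; first by rewrite !dropE.
have [le_i|lt_i] := leqP i (size w).
  by have := le_c (size w - i); rewrite !dropE subKn.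
by have := le_c 0; rewrite !dropE subn0 take_size take_oversize // ltnW.
Qed.

Theorem theorem4p6 (n : nat) (hn : 1 <= n) :
  exists f : {I : {set F2 n} | is_interval I} ->
             {w : (n.-1).-tuple motzkin_step |
               is_motzkin w && all (avoids w) motzkin_patterns},
    bijective f.
Proof.
case: n hn => // n _; rewrite /=.
(* A relation suits the correspondence because an interval provides its endpoints only
   existentially. *)
pose r (I : {I : {set F2 n.+1} | is_interval I})
    (w : {w : n.-tuple motzkin_step |
            is_motzkin w && all (avoids w) motzkin_patterns}) :=
  exists P Q : F2 n.+1,
    [/\ (P <= Q)%O, val I = [set R | (P <= R <= Q)%O],
        P = gap_path (rev (map low_gap (val w))) :> seq _
      & Q = gap_path (rev (map high_gap (val w))) :> seq _].
have szr (w : n.-tuple motzkin_step) (f : motzkin_step -> bool) :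
  size (rev (map f w)) = n by rewrite size_rev size_map size_tuple.
apply: (@rel_bijection _ _ r).
- case=> I intI; have /existsP[P /existsP[Q /andP[lePQ /eqP defI]]] := intI.
  have [s [szs sps defP]] := gap_pathP P.
  have [t [szt spt defQ]] := gap_pathP Q.
  have [|w [ws wt]] := @gaps_surj (rev s) (rev t).
    by rewrite !size_rev szs szt.
  have szw : size w == n by rewrite -(size_map low_gap) ws size_rev szs.
  have mot_w : is_motzkin w && all (avoids w) motzkin_patterns.
    rewrite avoids_motzkin_patterns ws wt !sparse_rev sps spt !andbT.
    apply/is_motzkin_drop_rev; rewrite ws wt !revK.
    exact/(stanley_le_gaps szs szt defP defQ).
  exists (exist _ (Tuple szw) mot_w), P, Q; split=> //=.
    by rewrite ws revK.
  by rewrite wt revK.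
- case=> w mot_w; have /andP[motw] := mot_w.
  rewrite avoids_motzkin_patterns -sparse_rev.
  rewrite -[sparse (map high_gap _)]sparse_rev.
  move=> /andP[spl sph].
  have [P defP] := F2_gap_path (szr w low_gap) spl.
  have [Q defQ] := F2_gap_path (szr w high_gap) sph.
  have lePQ : (P <= Q)%O.
    apply/(stanley_le_gaps (szr w low_gap) (szr w high_gap) defP defQ).
    exact/is_motzkin_drop_rev.
  have intI : is_interval [set R | (P <= R <= Q)%O].
    by apply/existsP; exists P; apply/existsP; exists Q; rewrite lePQ eqxx.
  by exists (exist _ [set R | (P <= R <= Q)%O] intI), P, Q.
- move=> I w w' [P [Q [lePQ defI defP defQ]]].
  move=> [P' [Q' [lePQ' defI' defP' defQ']]].
  have [eqP eqQ] : P = P' /\ Q = Q'.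
    by apply: itv_inj lePQ lePQ' _; rewrite -defI -defI'.
  apply/val_inj/val_inj/gaps_inj; apply/(can_inj revK)/gap_path_inj.
    by rewrite -defP -defP' eqP.
  by rewrite -defQ -defQ' eqQ.
- move=> I I' w [P [Q [_ defI defP defQ]]] [P' [Q' [_ defI' defP' defQ']]].
  have eqP : P = P' by apply/val_inj/val_inj; rewrite /= defP defP'.
  have eqQ : Q = Q' by apply/val_inj/val_inj; rewrite /= defQ defQ'.
  by apply/val_inj; rewrite defI defI' eqP eqQ.
Qed.
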